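(* Let $\alpha>0$, $\beta>0$ and $\varkappa\geq 1$ be real parameters and, for $\xi\in[0,2\pi]$, let $$G(\xi)=\begin{pmatrix}1-\omega_1 & -\mathbf{i}\omega_2\\ -\mathbf{i}\omega_2 & 1-\varkappa\omega_1\end{pmatrix},\qquad \omega_1=4\alpha\beta\sin^2\frac{\xi}{2},\quad \omega_2=\beta\sin\xi .$$ Then the spectral criterion $$\max_{0\leq\xi\leq 2\pi}\ \max_{l}\lambda_l\big((G^*G)(\xi)\big)\leq 1$$ holds if and only if $$\beta\leq\min\Big\{2\alpha,\ \frac{1}{2\varkappa\alpha}\Big\}.$$
   Context: Here $\mathbf{i}$ is the imaginary unit, $G^*$ is the conjugate transpose of $G$, $(G^*G)(\xi)=G(\xi)^*G(\xi)$, and $\lambda_l(A)$ denote the eigenvalues of a square matrix $A$ (real and nonnegative for $A=(G^*G)(\xi)$). The matrix $G(\xi)$ is the amplification matrix (symbol, obtained by substituting $\mathbf{y}^m_k=e^{\mathbf{i}k\xi}\mathbf{v}^m(\xi)$) of the linearized explicit two-level finite-difference scheme for $\mathbf{y}^m=(\rho^m\ u^m)^T$ on the mesh indexed by $k\in\mathbb{Z}$: $$\mathbf{y}^{m+1}_k=\begin{pmatrix}\alpha\beta&\frac{\beta}{2}\\ \frac{\beta}{2}&\varkappa\alpha\beta\end{pmatrix}\mathbf{y}^m_{k-1}+\begin{pmatrix}1-2\alpha\beta&0\\0&1-2\varkappa\alpha\beta\end{pmatrix}\mathbf{y}^m_k+\begin{pmatrix}\alpha\beta&-\frac{\beta}{2}\\-\frac{\beta}{2}&\varkappa\alpha\beta\end{pmatrix}\mathbf{y}^m_{k+1}.$$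 *)

(* Defs.v *)
From mathcomp Require Import all_boot all_order all_algebra.
From mathcomp Require Import complex.
From mathcomp Require Import classical_sets set_interval reals topology.
From mathcomp Require Import normedtype trigo.

Set Implicit Arguments.
Unset Strict Implicit.
Unset Printing Implicit Defensive.

Import Order.TTheory GRing.Theory Num.Theory.

Local Open Scope classical_set_scope.
Local Open Scope sesquilinear_scope.
Local Open Scope complex_scope.
Local Open Scope ring_scope.

Definition is_maximum (d : Order.disp_t) (T : porderType d) (A : set T) (m : T)
    : Prop :=
  A m /\ ubound A m.

Definition omega1 (R : realType) (alpha beta xi : R) : R :=
  4 * alpha * beta * sin (xi / 2) ^+ 2.

Definition omega2 (R : realType) (beta xi : R) : R := beta * sin xi.

Definition G (R : realType) (alpha beta kappa xi : R) : 'M[R[i]]_2 :=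
  \matrix_(i < 2, j < 2)
    if i != j then - 'i * (omega2 beta xi)%:C
    else if i == 0 then (1 - omega1 alpha beta xi)%:C
    else (1 - kappa * omega1 alpha beta xi)%:C.

Definition GstarG (R : realType) (alpha beta kappa xi : R) : 'M[R[i]]_2 :=
  (G alpha beta kappa xi)^t* *m G alpha beta kappa xi.

Definition spectrum (F : fieldType) (n : nat) (A : 'M[F]_n) : set F :=
  [set l | eigenvalue A l].

(* Eigenvalues range over all of R[i].  Its order is partial: z <= t%:C, with t
   real, forces z to be real, so the inner maximum mu xi is real and every
   complex eigenvalue is compared with it.  Both maxima are required to be
   attained. *)
Definition spectral_criterion (R : realType) (alpha beta kappa : R) : Prop :=
  exists (mu : R -> R) (M : R),
    [/\ forall xi, 0 <= xi <= 2 * pi ->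
          is_maximum (spectrum (GstarG alpha beta kappa xi)) (mu xi)%:C,
        is_maximum (mu @` [set xi | 0 <= xi <= 2 * pi]) M
      & M <= 1].

(* Main.v *)
Require Import Defs.
From mathcomp Require Import all_boot all_order all_algebra.
From mathcomp Require Import reals.
From mathcomp Require Import complex ring lra classical_sets trigo.

Import Order.TTheory GRing.Theory Num.Theory.

Local Open Scope ring_scope.

(** The matrix [G^* G] is 2 x 2 with real trace [t] and real determinant [d], and
    with [s = omega1], [w = omega2] its discriminant [t ^+ 2 - 4 * d] is the
    nonnegative number
    [(kappa - 1)^2 s^2 ((2 - s - kappa s)^2 + 4 w^2)].  Hence its spectrum
    consists of two real numbers, and the larger one is at most [1] iff [t <= 2]
    and the characteristic polynomial is nonnegative at [1], that is
    [0 <= 1 - t + d] ([larger_root_le1]).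

    The decisive point is a factorization.  Put [c = cos xi].  Then
    [s = 2 alpha beta (1 - c)], and [w^2 = s q] with
    [q = beta / (2 alpha) (1 + c)], since [sin^2 = (1 - c) (1 + c)].  In these
    variables
      [1 - t + d = s^2 (q - kappa (2 - s)) (q - (2 - kappa s))],
    while [t <= 2] keeps [q] at or below the midpoint of the two roots.  As
    [kappa >= 1], the smaller root is [2 - kappa s], and for [s > 0] the two
    conditions together mean [q <= 2 - kappa s] ([gram_root_le1]), i.e.
      [beta / (2 alpha) (1 + c) + 2 kappa alpha beta (1 - c) <= 2].
    This inequality is affine in [c], so it holds on [-1 <= c < 1] iff it holds at
    both ends of the interval: [c = -1] gives [beta <= 1 / (2 kappa alpha)] and
    the limit [c -> 1] gives [beta <= 2 alpha].  At [c = 1] itself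
    [G] is the identity, so the largest eigenvalue is exactly [1]; this is
    also why the outer maximum is attained as soon as the criterion holds
    pointwise. *)

(** * Eigenvalues of 2 x 2 matrices *)

Lemma det_mx2 (S : comNzRingType) (A : 'M[S]_2) :
  \det A = A 0 0 * A 1 1 - A 0 1 * A 1 0.
Proof.
have lift01 : lift (0 : 'I_2) (0 : 'I_1) = 1 by apply/val_inj.
have lift10 : lift (1 : 'I_2) (0 : 'I_1) = 0 by apply/val_inj.
rewrite (expand_det_row A 0) !big_ord_recl big_ord0 /cofactor !det_mx11 !mxE.
by rewrite /= !lift01 !lift10 /= expr0 expr1; ring.
Qed.

Lemma mxtrace_mx2 (S : pzRingType) (A : 'M[S]_2) : \tr A = A 0 0 + A 1 1.
Proof.
rewrite /mxtrace !big_ord_recl big_ord0 addr0.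
by congr (_ + A _ _); apply/val_inj.
Qed.

Lemma eigenvalue_mx2 (F : fieldType) (A : 'M[F]_2) (z : F) :
  eigenvalue A z = (z ^+ 2 - \tr A * z + \det A == 0).
Proof.
rewrite eigenvalue_root_char rootE /char_poly !det_mx2 mxtrace_mx2 !mxE /=.
rewrite !(hornerD, hornerN, hornerM, hornerX, hornerC).
by congr (_ == 0); ring.
Qed.

(** * Real roots of a monic quadratic *)

Definition larger_root {R : rcfType} (t d : R) : R :=
  (t + Num.sqrt (t ^+ 2 - 4 * d)) / 2.

Definition smaller_root {R : rcfType} (t d : R) : R :=
  (t - Num.sqrt (t ^+ 2 - 4 * d)) / 2.

Lemma smaller_root_le (R : rcfType) (t d : R) :
  smaller_root t d <= larger_root t d.
Proof.
rewrite /smaller_root /larger_root.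
by have := sqrtr_ge0 (t ^+ 2 - 4 * d); lra.
Qed.

Lemma monic_quadratic_root (R : rcfType) (t d : R) (z : R[i]) :
  0 <= t ^+ 2 - 4 * d ->
  (z ^+ 2 - t%:C%C * z + d%:C%C == 0) =
  (z == (larger_root t d)%:C%C) || (z == (smaller_root t d)%:C%C).
Proof.
move=> disc_ge0.
have Dt : t = larger_root t d + smaller_root t d.
  by rewrite /smaller_root /larger_root; lra.
have Dd : d = larger_root t d * smaller_root t d.
  have := sqr_sqrtr disc_ge0; rewrite /smaller_root /larger_root.
  by move: (Num.sqrt _) => r Dr; apply: (@mulfI _ 4); move: Dr; lra.
rewrite -(subr_eq0 z) -(subr_eq0 z (smaller_root _ _)%:C%C) -mulf_eq0.
move: (larger_root t d) (smaller_root t d) Dt Dd => a b -> ->.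
by rewrite rmorphD rmorphM /=; congr (_ == 0); ring.
Qed.

(** A parabola is nonnegative at [1] both when [1] lies to the right of its roots
    and when it lies to the left; [t <= 2] puts the vertex [t / 2] on the left
    of [1] and selects the first case. *)
Lemma larger_root_le1 (R : rcfType) (t d : R) :
  larger_root t d <= 1 = (t <= 2) && (0 <= 1 - t + d).
Proof.
rewrite /larger_root; have := sqrtr_ge0 (t ^+ 2 - 4 * d).
have [t_le2|t_gt2] /= := leP t 2 => sqrt_ge0; last first.
  by apply/negbTE; rewrite -ltNge; lra.
have -> : 0 <= 1 - t + d = (t ^+ 2 - 4 * d <= (2 - t) ^+ 2).
  by apply/idP/idP; nra.
rewrite -[RHS]ler_sqrt ?sqr_ge0 // sqrtr_sqr ger0_norm; last by lra.
by apply/idP/idP; lra.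
Qed.

(** * The spectrum of the Gram matrix of the symbol *)

Definition gram_trace {R : pzRingType} (kappa s w : R) : R :=
  (1 - s) ^+ 2 + (1 - kappa * s) ^+ 2 + 2 * w ^+ 2.

Definition gram_det {R : pzRingType} (kappa s w : R) : R :=
  ((1 - s) * (1 - kappa * s) + w ^+ 2) ^+ 2.

Lemma mxtrace_GstarG (R : realType) (alpha beta kappa xi : R) :
  \tr (GstarG alpha beta kappa xi) =
  (gram_trace kappa (omega1 alpha beta xi) (omega2 beta xi))%:C%C.
Proof.
rewrite mxtrace_mx2 /GstarG !mxE !big_ord_recl !big_ord0 !mxE /=.
by rewrite -!complexiE /gram_trace; simpc; congr (_ +i* _)%C; ring.
Qed.

Lemma det_GstarG (R : realType) (alpha beta kappa xi : R) :
  \det (GstarG alpha beta kappa xi) =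
  (gram_det kappa (omega1 alpha beta xi) (omega2 beta xi))%:C%C.
Proof.
rewrite /GstarG det_mulmx det_map_mx det_tr det_mx2 !mxE /=.
by rewrite -!complexiE /gram_det; simpc; congr (_ +i* _)%C; ring.
Qed.

Lemma gram_disc_ge0 (R : realDomainType) (kappa s w : R) :
  0 <= gram_trace kappa s w ^+ 2 - 4 * gram_det kappa s w.
Proof.
have -> : gram_trace kappa s w ^+ 2 - 4 * gram_det kappa s w =
    ((kappa - 1) * s) ^+ 2 * ((2 - s - kappa * s) ^+ 2 + 4 * w ^+ 2).
  by rewrite /gram_trace /gram_det; ring.
by rewrite mulr_ge0 ?addr_ge0 ?sqr_ge0 // mulr_ge0 ?sqr_ge0.
Qed.

Definition gram_root {R : rcfType} (kappa s w : R) : R :=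
  larger_root (gram_trace kappa s w) (gram_det kappa s w).

Lemma is_maximum_gram_root (R : realType) (alpha beta kappa xi : R) :
  is_maximum (spectrum (GstarG alpha beta kappa xi))
    (gram_root kappa (omega1 alpha beta xi) (omega2 beta xi))%:C%C.
Proof.
have spectrumE z : spectrum (GstarG alpha beta kappa xi) z <->
    z = (gram_root kappa (omega1 alpha beta xi) (omega2 beta xi))%:C%C \/
    z = (smaller_root
           (gram_trace kappa (omega1 alpha beta xi) (omega2 beta xi))
           (gram_det kappa (omega1 alpha beta xi) (omega2 beta xi)))%:C%C.
  rewrite /spectrum /= eigenvalue_mx2 mxtrace_GstarG det_GstarG.
  rewrite monic_quadratic_root ?gram_disc_ge0 //.
  by split=> [/orP[] /eqP|[] ->]; rewrite ?eqxx ?orbT //; [left|right].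
split; first by apply/spectrumE; left.
by move=> z /spectrumE[] -> //; rewrite lecR smaller_root_le.
Qed.

(** Setting [xi = 0] makes the symbol the identity, so the value [1] is always
    taken; hence a pointwise bound by [1] already provides the attained outer
    maximum. *)
Lemma spectral_criterionP (R : realType) (alpha beta kappa : R) :
  spectral_criterion alpha beta kappa <->
  forall xi, 0 <= xi <= 2 * pi ->
    gram_root kappa (omega1 alpha beta xi) (omega2 beta xi) <= 1.
Proof.
split=> [[mu [M [mu_max [_ M_ub] M_le1]]] xi xi_in | le1].
  apply: le_trans M_le1.
  apply: (@le_trans _ _ (mu xi)); last by apply: M_ub; exists xi.
  rewrite -lecR; have [_ mu_ub] := mu_max _ xi_in.
  by apply: mu_ub; have [] := @is_maximum_gram_root R alpha beta kappa xi.
exists (fun xi => gram_root kappa (omega1 alpha beta xi) (omega2 beta xi)), 1.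
split=> //; first by move=> xi _; exact: is_maximum_gram_root.
split; last by move=> _ [xi xi_in <-]; exact: le1.
exists 0; first by rewrite /= lexx mulr_ge0 // pi_ge0.
rewrite /omega1 /omega2 mul0r sin0 expr0n /= !mulr0.
rewrite /gram_root /larger_root /gram_trace /gram_det.
have -> : ((1 - 0) ^+ 2 + (1 - kappa * 0) ^+ 2 + 2 * 0 ^+ 2) ^+ 2 -
    4 * ((1 - 0) * (1 - kappa * 0) + 0 ^+ 2) ^+ 2 = 0 :> R by ring.
by rewrite sqrtr0; field.
Qed.

(** * The pointwise stability condition *)

Lemma gram_root_le1 (R : rcfType) (kappa s q w : R) :
  1 <= kappa -> 0 < s -> 0 <= q -> w ^+ 2 = s * q ->
  gram_root kappa s w <= 1 = (q <= 2 - kappa * s).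
Proof.
move=> kappa_ge1 s_gt0 q_ge0 Dw.
rewrite /gram_root larger_root_le1 /gram_trace /gram_det Dw.
set t := (X in X <= 2); set d := (X in 1 - t + X).
have -> : 0 <= 1 - t + d =
    (0 <= (q - kappa * (2 - s)) * (q - (2 - kappa * s))).
  rewrite -[RHS](pmulr_rge0 _ (exprn_gt0 2 s_gt0)); congr (0 <= _).
  by rewrite /t /d; ring.
have -> : (t <= 2) =
    (2 * (q - (2 - kappa * s)) <= (kappa - 1) * (2 - (kappa - 1) * s)).
  rewrite -subr_ge0 -[RHS]subr_ge0 -[RHS](pmulr_rge0 _ s_gt0); congr (0 <= _).
  by rewrite /t; ring.
have [q_le|q_gt] := leP q (2 - kappa * s); last first.
  (* Beyond the smaller root, nonnegativity of the product forces q to reach the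
     larger root as well, hence to exceed the midpoint of the roots, which the
     bound given by the trace excludes. *)
  apply/negbTE/negP => /andP[trace_le]; rewrite pmulr_lge0 ?subr_gt0 // => q_ge.
  have : 0 <= s * (kappa - 1) ^+ 2 by rewrite mulr_ge0 ?sqr_ge0 // ltW.
  by nra.
(* Since kappa s <= 2 - q <= 2, the right-hand side of the trace condition is
   nonnegative, while its left-hand side is not positive. *)
have ks_le2 : (kappa - 1) * s <= 2 by nra.
apply/andP; split.
  apply: (@le_trans _ _ 0); first by lra.
  by apply: mulr_ge0; lra.
by apply: mulr_le0; nra.
Qed.

Lemma omega1_cos (R : realType) (alpha beta xi : R) :
  omega1 alpha beta xi = 2 * alpha * beta * (1 - cos xi).
Proof.
rewrite /omega1 -{2}[xi](@divfK _ 2) ?pnatr_eq0 // mulr_natr cos_mulr2n.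
by rewrite cos2sin2; ring.
Qed.

Lemma gram_root_omega_le1 (R : realType) (alpha beta kappa xi : R) :
  0 < alpha -> 0 < beta -> 1 <= kappa -> cos xi < 1 ->
  gram_root kappa (omega1 alpha beta xi) (omega2 beta xi) <= 1 =
  (beta / (2 * alpha) * (1 + cos xi)
     + 2 * kappa * alpha * beta * (1 - cos xi) <= 2).
Proof.
move=> alpha_gt0 beta_gt0 kappa_ge1 cos_lt1.
rewrite (@gram_root_le1 _ kappa _ (beta / (2 * alpha) * (1 + cos xi))) //.
- rewrite omega1_cos lerBrDr; congr (_ + _ <= _); ring.
- by rewrite omega1_cos !mulr_gt0 ?subr_gt0.
- apply: mulr_ge0; last by have := cos_geN1 xi; lra.
  by rewrite divr_ge0 ?ltW // mulr_gt0.
- rewrite omega1_cos /omega2 exprMn sin2cos2; field.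
  by rewrite gt_eqF.
Qed.

(** * The stability threshold *)

Theorem theorem2 (R : realType) (alpha beta kappa : R)
    (halpha : 0 < alpha) (hbeta : 0 < beta) (hkappa : 1 <= kappa) :
  spectral_criterion alpha beta kappa <->
  beta <= Num.min (2 * alpha) (1 / (2 * kappa * alpha)).
Proof.
have a2_gt0 : 0 < 2 * alpha by rewrite mulr_gt0.
have ka2_gt0 : 0 < 2 * kappa * alpha by rewrite !mulr_gt0 // (lt_le_trans ltr01).
rewrite spectral_criterionP le_min ler_pdivlMr //.
split=> [stable | /andP[le_2alpha le_inv] xi xi_in].
  have cond c : -1 <= c < 1 ->
      beta / (2 * alpha) * (1 + c) + 2 * kappa * alpha * beta * (1 - c) <= 2.
    move=> /andP[c_geN1 c_lt1].
    have c_in : -1 <= c <= 1 by rewrite c_geN1 ltW.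
    have [/andP[acos_ge0 acos_lepi] acosK] := acos_def c_in.
    rewrite -acosK -gram_root_omega_le1 ?acosK //.
    by apply: stable; rewrite acos_ge0 /=; have := pi_ge0 R; lra.
  have at_N1 := cond (-1) ltac:(lra).
  apply/andP; split; last by lra.
  rewrite leNgt; apply/negP => gt_2alpha.
  have inv_lt1 : 0 < 2 * alpha / beta < 1.
    by rewrite divr_gt0 //= ltr_pdivrMr ?mul1r.
  (* This value of c, strictly between -1 and 1, makes the first term alone equal
     beta / (2 alpha) + 1, which exceeds 2. *)
  have c_in : -1 <= 2 * alpha / beta < 1 by case/andP: inv_lt1; lra.
  have := cond _ c_in.
  have -> : beta / (2 * alpha) * (1 + 2 * alpha / beta) = beta / (2 * alpha) + 1.
    by field; rewrite !gt_eqF.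
  have : 1 < beta / (2 * alpha) by rewrite ltr_pdivlMr ?mul1r.
  have : 0 < 2 * kappa * alpha * beta * (1 - 2 * alpha / beta).
    apply: mulr_gt0; first exact: mulr_gt0.
    by rewrite subr_gt0; case/andP: inv_lt1.
  by lra.
have ratio_le1 : beta / (2 * alpha) <= 1 by rewrite ler_pdivrMr ?mul1r.
have [cos_lt1|cos_ge1] := ltP (cos xi) 1.
  by rewrite gram_root_omega_le1 //; have := cos_geN1 xi; nra.
(* Here cos xi = 1, so both frequencies vanish and the symbol is the identity. *)
have cos1 : cos xi = 1 by apply/le_anti; rewrite cos_le1.
have omega2_sq0 : omega2 beta xi ^+ 2 = 0.
  by rewrite /omega2 exprMn sin2cos2 cos1; ring.
rewrite /gram_root larger_root_le1 /gram_trace /gram_det omega2_sq0 omega1_cos cos1.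
by apply/andP; split; lra.
Qed.
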